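(* Let $G$ be a residually finite $D(1)$-group. Then $G$ is a finite group.
   Context: Groups may be finite or infinite. A non-trivial element $x$ of a group $G$ (and its conjugacy class $x^G$) is called deficient if $\langle x\rangle$ is properly contained in $C_G(x)$, and non-deficient if $\langle x\rangle = C_G(x)$. A $D(1)$-group is a group with exactly one deficient non-trivial conjugacy class. A group $G$ is residually finite if for each non-trivial $g\in G$ there exists a normal subgroup $M(g)$ of $G$ with $g\notin M(g)$ and $G/M(g)$ finite. *)

(* Defs.v *)
(* [groupType] is MathComp's structure of abstract, possibly infinite, groups;
   subsets are the classical [set G] of mathcomp-classical. *)
From HB Require Import structures.
From mathcomp Require Import all_boot.
From mathcomp Require Import boolp classical_sets functions cardinality.

Set Implicit Arguments.
Unset Strict Implicit.
Unset Printing Implicit Defensive.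

Local Open Scope classical_set_scope.
Local Open Scope group_scope.

(* There is no integer exponent on [groupType]: the powers with exponent in Z
   are written as the x ^+ n and the x ^- n = (x ^+ n)^-1 with n : nat. *)
Definition cyclic_subgroup (G : groupType) (x : G) : set G :=
  [set y | exists n : nat, y = x ^+ n \/ y = x ^- n].

Definition centralizer (G : groupType) (x : G) : set G :=
  [set y | commute x y].

Definition conj_class (G : groupType) (x : G) : set G :=
  [set x ^ g | g in [set: G]].

Definition deficient (G : groupType) (x : G) : Prop :=
  x <> 1 /\ cyclic_subgroup x `<` centralizer x.

Definition deficient_class (G : groupType) (C : set G) : Prop :=
  exists2 x : G, deficient x & C = conj_class x.

Definition D1_group (G : groupType) : Prop :=
  exists! C : set G, deficient_class C.

Definition normal_subgroup (G : groupType) (M : set G) : Prop :=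
  group_closed [in M] /\ (forall m g : G, M m -> M (m ^ g)).

Definition cosets (G : groupType) (M : set G) : set (set G) :=
  [set [set m * x | m in M] | x in [set: G]].

Definition residually_finite (G : groupType) : Prop :=
  forall g : G, g <> 1 ->
    exists M : set G,
      [/\ normal_subgroup M, ~ M g & finite_set (cosets M)].

(* Main.v *)
Require Import Defs.
From HB Require Import structures.
From mathcomp Require Import all_boot.
From mathcomp Require Import boolp classical_sets functions cardinality.

(** The group is finite because it contains an involution [t] that inverts a
    normal subgroup of finite index.

    The group is periodic ([periodic]).  If [x] had infinite order, then [x]
    would centralize each [x ^+ n] with [n >= 2] without being one of its powers,
    so all these powers would be deficient and hence conjugate.  A normal
    subgroup of finite index contains some [x ^+ n] with [n >= 2]; it would then
    contain [x ^+ 2] as well, against residual finiteness.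

    The group contains an involution ([exists_involution]).  If [d] is deficient, so is
    its inverse, and there is [g] with [d ^ g = d^-1].  Either [d] is an
    involution, or [g] has even order and a power of it is an involution [t].

    Let [N] be normal of finite index with [t] and [d] outside [N].  As [N] misses
    the only deficient class, its non-trivial elements have their own powers as
    centralizer.  For [y] in [N], the square [(t * y) ^+ 2] is in [N] and
    commutes with [t * y], which is outside [N]; hence it is trivial, that is,
    [t] inverts [y].  A group on which inversion is a homomorphism is abelian, so
    [N] is contained in the centralizer of any of its non-trivial elements, and
    this centralizer is a finite cyclic group.  Thus [N] is finite, and so is the
    whole group. *)

Set Implicit Arguments.
Unset Strict Implicit.
Unset Printing Implicit Defensive.

Local Open Scope group_scope.
Local Open Scope classical_set_scope.

Section NormalSubgroup.

Variables (G : groupType) (M : set G).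
Hypothesis nM : normal_subgroup M.

Lemma normal_subgroup1 : M 1.
Proof. by case: nM => -[/set_mem]. Qed.

Lemma normal_subgroupV x : M x -> M x^-1.
Proof. by case: nM => /group_closedV clV _ /mem_set/clV/set_mem. Qed.

Lemma normal_subgroupM x y : M x -> M y -> M (x * y).
Proof.
by case: nM => /group_closedM clM _ /mem_set Mx /mem_set My; apply/set_mem/clM.
Qed.

Lemma normal_subgroupX x n : M x -> M (x ^+ n).
Proof.
move=> Mx; elim: n => [|n IHn]; first by rewrite expg0; exact: normal_subgroup1.
by rewrite expgS; exact: normal_subgroupM.
Qed.

Lemma normal_subgroup_cyclic x : M x -> cyclic_subgroup x `<=` M.
Proof.
move=> Mx _ [n [->|->]]; first exact: normal_subgroupX.
exact/normal_subgroupV/normal_subgroupX.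
Qed.

Lemma normal_subgroupJ x g : M (x ^ g) -> M x.
Proof. by move=> /(nM.2 _ g^-1); rewrite conjgK. Qed.

Lemma cosetP x y : [set m * x | m in M] y <-> M (y / x).
Proof.
split=> [[m Mm <-]|Myx]; first by rewrite mulgK.
by exists (y / x); rewrite ?mulgVK.
Qed.

(** Two powers of [x] lie in the same coset of [M], and their quotient is a
    power of [x] in [M]. *)
Lemma finite_index_power_mem x :
  finite_set (cosets M) -> exists2 n : nat, (0 < n)%N & M (x ^+ n).
Proof.
move=> finM; pose f (n : nat) : set G := [set m * x ^+ n | m in M].
apply: contrapT => noM; apply: infinite_nat.
have f_inj : {in [set: nat] &, injective f}.
  suff lt_neq i j : (i < j)%N -> f i = f j -> False.
    move=> i j _ _ fij; have [ltij|ltji|//] := ltngtP i j.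
    - by case: (lt_neq _ _ ltij).
    - by case: (lt_neq _ _ ltji).
  move=> ltij fij; apply: noM; exists (j - i)%N; first by rewrite subn_gt0.
  rewrite expgnFr 1?ltnW//; apply/cosetP; change (f i (x ^+ j)); rewrite fij.
  by apply/cosetP; rewrite mulgV; exact: normal_subgroup1.
rewrite -(eq_finite_set (inj_card_eq f_inj)).
by apply: sub_finite_set finM => _ [n _ <-]; exists (x ^+ n).
Qed.

End NormalSubgroup.

Lemma normal_subgroupI (G : groupType) (M N : set G) :
  normal_subgroup M -> normal_subgroup N -> normal_subgroup (M `&` N).
Proof.
move=> nM nN; split; last first.
  by move=> m g [Mm Nm]; split; [exact: nM.2|exact: nN.2].
split; first by apply/mem_set; split; exact: normal_subgroup1.
move=> x y /set_mem[Mx Nx] /set_mem[My Ny]; apply/mem_set.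
by split; apply: normal_subgroupM => //; exact: normal_subgroupV.
Qed.

Lemma finite_cosetsI (G : groupType) (M N : set G) :
  normal_subgroup M -> normal_subgroup N ->
  finite_set (cosets M) -> finite_set (cosets N) ->
  finite_set (cosets (M `&` N)).
Proof.
move=> nM nN finM finN; apply: sub_finite_set (finite_image2 setI finM finN).
move=> _ [x _ <-]; exists [set m * x | m in M]; first by exists x.
exists [set m * x | m in N]; first by exists x.
apply/seteqP; split=> y.
  by move=> [/cosetP My /cosetP Ny]; exists (y / x); rewrite ?mulgVK.
by move=> [m [Mm Nm] <-]; split; exists m.
Qed.

Lemma finite_by_finite_index (G : groupType) (M : set G) :
  normal_subgroup M -> finite_set M -> finite_set (cosets M) ->
  finite_set [set: G].
Proof.
move=> nM finM fin_cosets.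
apply: (@sub_finite_set _ _ (\bigcup_(C in cosets M) C)); last first.
  by apply: bigcup_finite => // _ [x _ <-]; exact: finite_image.
move=> x _; exists [set m * x | m in M]; first by exists x.
by exists 1; [exact: normal_subgroup1|rewrite mul1g].
Qed.

Section CyclicSubgroup.

Variable G : groupType.
Implicit Types x y : G.

Lemma cyclic_subgroup_sub_centralizer x : cyclic_subgroup x `<=` centralizer x.
Proof.
move=> _ [n [->|->]]; first exact/commuteX/commute_refl.
exact/commuteV/commuteX/commute_refl.
Qed.

Lemma nondeficient_centralizer x :
  x <> 1 -> ~ deficient x -> centralizer x `<=` cyclic_subgroup x.
Proof.
move=> x1 ndx; apply: contrapT => nsub; apply: ndx; split=> //.
by split=> //; exact: cyclic_subgroup_sub_centralizer.
Qed.

Lemma finite_cyclic_subgroup x n :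
  (0 < n)%N -> x ^+ n = 1 -> finite_set (cyclic_subgroup x).
Proof.
move=> n0 xn1.
have red k : x ^+ k = x ^+ (k %% n).
  by rewrite {1}(divn_eq k n) expgnDr mulnC expgnA xn1 expg1n mul1g.
have fin_pow (h : G -> G) : finite_set [set h (x ^+ i) | i in `I_n].
  exact/finite_image/finite_II.
apply: (@sub_finite_set _ _ ([set x ^+ i | i in `I_n] `|`
                             [set x ^- i | i in `I_n])).
  move=> _ [k [->|->]]; [left|right]; exists (k %% n)%N => /=.
  - by rewrite ltn_mod.
  - by rewrite -red.
  - by rewrite ltn_mod.
  - by rewrite -red.
by rewrite finite_setU; split; [exact: (fin_pow id)|exact: (fin_pow (fun z => z^-1))].
Qed.

Lemma deficientV x : deficient x -> deficient x^-1.
Proof.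
move=> [x1 [_ nsub]]; split.
  by move/(congr1 (fun z => z^-1)); rewrite invgK invg1.
split; first exact: cyclic_subgroup_sub_centralizer.
apply: contra_not nsub => sub y /commute_sym/commuteV/commute_sym/sub[n].
by rewrite expVgn invgK => -[]->; exists n; [right|left].
Qed.

(** The witness is [x] itself: it commutes with [x ^+ n], but an equation
    [x = x ^+ (n * k)] or [x = x ^- (n * k)] gives [x] finite order, because
    [n * k] is not [1]. *)
Lemma deficient_power x n :
    (forall k : nat, (0 < k)%N -> x ^+ k <> 1) -> (1 < n)%N ->
  deficient (x ^+ n).
Proof.
move=> x_inf n1; split; first by apply: x_inf; exact: ltnW.
split=> [|sub]; first exact: cyclic_subgroup_sub_centralizer.
have /sub[k] : centralizer (x ^+ n) x.
  exact/commute_sym/commuteX/commute_refl.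
rewrite -expgnA => -[xE|xE].
- case: k => [|k] in xE.
    by apply: (x_inf 1%N); rewrite // expg1 {1}xE muln0.
  have nk1 : (1 < n * k.+1)%N by rewrite (leq_trans n1)// leq_pmulr.
  apply: (x_inf (n * k.+1 - 1)%N); first by rewrite subn_gt0.
  by rewrite expgnFr 1?ltnW// -xE expg1 mulgV.
- apply: (x_inf (n * k).+1) => //.
  by rewrite expgS {1}xE mulVg.
Qed.

(** Conjugation by [x ^+ k] maps [y] to [y^-1] or to [y] according to the parity
    of [k], so [x] has even order. *)
Lemma even_order_involution x y n :
    (0 < n)%N -> x ^+ n = 1 -> y ^ x = y^-1 -> y <> y^-1 ->
  exists2 t : G, t <> 1 & t * t = 1.
Proof.
move=> n0 xn1 yx yV.
have ex_n : exists n, (0 < n)%N && (x ^+ n == 1).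
  by exists n; rewrite n0; apply/eqP.
case: (ex_minnP ex_n) => m /andP[m0 /eqP xm1] m_min.
have yXk k : y ^ (x ^+ k) = if odd k then y^-1 else y.
  elim: k => [|k IHk]; first by rewrite expg0 conjg1.
  rewrite expgSr conjgM IHk /=; case: (odd k) => //=.
  by rewrite conjVg yx invgK.
have m_even : ~~ odd m.
  by apply/negP => m_odd; move: (yXk m); rewrite m_odd xm1 conjg1.
have mE : m = (m./2 + m./2)%N by rewrite addnn even_halfK.
have m2_gt0 : (0 < m./2)%N by move: m0; rewrite {1}mE; case: (m./2).
exists (x ^+ m./2); last by rewrite -expgnDr -mE.
move=> /eqP xm2; have := m_min m./2; rewrite m2_gt0 xm2 => /(_ isT).
by rewrite {1}mE -{3}[m./2]addn0 leq_add2l leqNgt m2_gt0.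
Qed.

End CyclicSubgroup.

Lemma D1_conjugate (G : groupType) (x y : G) :
  D1_group G -> deficient x -> deficient y -> exists g, x ^ g = y.
Proof.
move=> [C [_ uniqC]] dx dy.
have /uniqC Cx : deficient_class (conj_class x) by exists x.
have /uniqC Cy : deficient_class (conj_class y) by exists y.
have : conj_class x y by rewrite -Cx Cy; exists 1; rewrite ?conjg1.
by case=> g _ <-; exists g.
Qed.

Lemma periodic (G : groupType) : residually_finite G -> D1_group G ->
  forall x : G, exists2 n : nat, (0 < n)%N & x ^+ n = 1.
Proof.
move=> hrf hD x; apply: contrapT => noX.
have x_inf k : (0 < k)%N -> x ^+ k <> 1 by move=> k0 xk; apply: noX; exists k.
have [M [nM NMx2 finM]] := hrf _ (x_inf 2 isT).
have [n n0 Mxn] := finite_index_power_mem nM x finM.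
have n2 : (1 < n * 2)%N by rewrite -[2%N]mul1n leq_mul2r n0 orbT.
have [g x2g] := D1_conjugate hD (deficient_power x_inf (isT : (1 < 2)%N))
                                (deficient_power x_inf n2).
apply: NMx2; apply: (normal_subgroupJ nM (g := g)).
by rewrite x2g expgnA; exact: normal_subgroupX.
Qed.

Lemma exists_involution (G : groupType) :
    residually_finite G -> D1_group G ->
  exists2 t : G, t <> 1 & t * t = 1.
Proof.
move=> hrf hD; have [C [[d dd _] _]] := hD.
have [g dg] := D1_conjugate hD dd (deficientV dd).
have [dV|dV] := pselect (d = d^-1).
  by exists d; [exact: dd.1|rewrite {1}dV mulVg].
have [n n0 gn1] := periodic hrf hD g.
exact: (even_order_involution n0 gn1 dg dV).
Qed.

(** Through [scN], an element that commutes with a non-trivial element of [N]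
    lies in [N]. *)
Section SelfCentralizing.

Variables (G : groupType) (N : set G).
Hypothesis nN : normal_subgroup N.
Hypothesis scN : forall y, N y -> y <> 1 -> centralizer y `<=` cyclic_subgroup y.

(** [y ^ t * y] is the square of [t * y], hence commutes with it; a non-trivial
    square would have [t * y], and therefore [t], among the elements of [N]. *)
Lemma involution_inverts t y : t * t = 1 -> ~ N t -> N y -> y ^ t = y^-1.
Proof.
move=> tt NNt Ny; have tV : t^-1 = t by exact: mulg1_eq.
have ty2 : t * y * (t * y) = y ^ t * y by rewrite conjgE tV !mulgA.
have Nty2 : N (t * y * (t * y)).
  by rewrite ty2; apply: normal_subgroupM => //; exact: nN.2.
have [ty2_1|ty2_1] := pselect (t * y * (t * y) = 1).
  by rewrite -[y ^ t]invgK; congr (_^-1); apply: mulg1_eq; rewrite -ty2.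
have : centralizer (t * y * (t * y)) (t * y).
  exact/commute_sym/commuteM.
move=> /(scN Nty2 ty2_1)/(normal_subgroup_cyclic nN Nty2) Nty.
case: NNt; rewrite -[t](mulgK y).
by apply: normal_subgroupM => //; exact: normal_subgroupV.
Qed.

Lemma involution_abelian t x y :
  t * t = 1 -> ~ N t -> N x -> N y -> commute x y.
Proof.
move=> tt NNt Nx Ny; have inv_t := involution_inverts tt NNt.
apply: invg_inj; rewrite -inv_t; last exact: normal_subgroupM.
by rewrite conjMg !inv_t// invgM.
Qed.

End SelfCentralizing.

Theorem theorem9 (G : groupType) (hrf : residually_finite G)
  (hD : D1_group G) : finite_set [set: G].
Proof.
have [t t1 tt] := exists_involution hrf hD.
have [C [[d dd _] _]] := hD.
have [M1 [nM1 NM1t finM1]] := hrf t t1.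
have [M2 [nM2 NM2d finM2]] := hrf d dd.1.
pose N := M1 `&` M2; have nN : normal_subgroup N by exact: normal_subgroupI.
have NNt : ~ N t by move=> [].
have scN y : N y -> y <> 1 -> centralizer y `<=` cyclic_subgroup y.
  move=> [_ M2y] y1; apply: nondeficient_centralizer => // dy.
  have [g dg] := D1_conjugate hD dd dy.
  by apply: NM2d; apply: (normal_subgroupJ nM2 (g := g)); rewrite dg.
apply: (finite_by_finite_index nN); last exact: finite_cosetsI.
have [[y Ny y1]|N1] := pselect (exists2 y, N y & y <> 1); last first.
  apply: (@sub_finite_set _ _ [set 1]); last exact: finite_set1.
  by move=> y Ny; apply: contrapT => y1; apply: N1; exists y.
have [n n0 yn1] := periodic hrf hD y.
apply: sub_finite_set (finite_cyclic_subgroup n0 yn1) => x Nx.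
exact/(scN y Ny y1)/(involution_abelian nN scN tt NNt).
Qed.
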